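(* Let $d\ge2$ and let $Q_d$ be the $d$-dimensional hypercube. The minimum time of a one-way communication graph for universal exchange on $Q_d$ is $2^d$. Moreover, the minimum time of a one-way communication graph in which each vertex communicates simultaneously with all vertices at distance $d-1$ and $d$ from it is $2d$, and for $1\le s\le d-1$ the minimum time of a one-way communication graph in which each vertex communicates with all vertices at distance $s$ from it is $2\binom{d-1}{s-1}$. In addition, such optimal communication graphs can be chosen so that on odd time steps the edges used can be directed arbitrarily, with each such edge used in the opposite direction on the next time step.
   Context: $Q_d$ has vertex set $\{0,1\}^d$, with $u,v$ adjacent iff they differ in exactly one coordinate (distance = Hamming distance); every edge is present in both directions. A task graph is a finite sequence $(e_i)$ of directed edges labeled by positive integer times $t(e_i)$ such that (i) $t(e_i)<t(e_j)$ implies $e_i<e_j$ or $e_i,e_j$ incomparable, and (ii) $t(e_i)=t(e_j)$ implies $i=j$ or $e_i,e_j$ incomparable, where $e_i<e_j$ means there is a directed path in the task graph beginning with $e_i$ and ending with $e_j$; its time is its maximum label. A one-way communication graph is a collection of task graphs in which no two edge occurrences joining the same two vertices (in either direction) carry the same label; its time is the maximum time of its task graphs. For a set $\Sigma$ of distances, a communication graph in which each vertex communicates with all vertices at distance in $\Sigma$ consists of, for every ordered pair $(x,y)$ with $d(x,y)\in\Sigma$, a task graph that is a directed path from $x$ to $y$ (each pair gets its own path, carrying a distinct message). Universal exchange is the case $\Sigma=\{1,\dots,d\}$. *)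

(* Defs.v *)
From HB Require Import structures.
From mathcomp Require Import all_boot.

Set Implicit Arguments.
Unset Strict Implicit.
Unset Printing Implicit Defensive.

Section CommunicationGraphs.

Variables (V : finType) (adj : rel V).

Definition dedge : Type := V * V.

(* [(u, v, t)] is the directed edge from [u] to [v] with label [t]. *)
Definition tedge : Type := dedge * nat.

Definition edge_of (e : tedge) : dedge := e.1.
Definition label (e : tedge) : nat := e.2.

Definition same_ends (a b : dedge) : bool :=
  (a == b) || (a == (b.2, b.1)).

(* [pairmap pair x p] lists the consecutive pairs of [x :: p]; vertices on a
   path are pairwise distinct. *)
Definition dipath (x y : V) (w : seq dedge) : Prop :=
  exists p : seq V, [/\ uniq (x :: p), last x p = y & w = pairmap pair x p].

Section TaskGraph.

Variable E : seq tedge.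

(* Edges are referred to by their position, since the same directed edge may
   occur several times in a task graph. *)
Definition occ (i : 'I_(size E)) : tedge := tnth (in_tuple E) i.

Definition precedes (i j : 'I_(size E)) : Prop :=
  exists ks : seq 'I_(size E), last i ks = j /\
    exists x y : V, dipath x y [seq edge_of (occ k) | k <- i :: ks].

Definition incomparable (i j : 'I_(size E)) : Prop :=
  ~ precedes i j /\ ~ precedes j i.

Definition task_graph : Prop :=
  [/\ forall i, adj (edge_of (occ i)).1 (edge_of (occ i)).2,
      forall i, 0 < label (occ i),
      forall i j, label (occ i) < label (occ j) ->
        precedes i j \/ incomparable i j
    & forall i j, label (occ i) = label (occ j) -> i = j \/ incomparable i j].

Definition task_time : nat := \max_(e <- E) label e.

(* The listing order of a task graph is immaterial, so its edges may have to
   be reordered to be traversed from [x] to [y]. *)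
Definition is_dipath_from_to (x y : V) : Prop :=
  exists2 w, dipath x y w & perm_eq [seq edge_of e | e <- E] w.

End TaskGraph.

Section Collection.

Variables (I : finType) (G : I -> seq tedge).

Definition one_way_comm_graph : Prop :=
  (forall m, task_graph (G m)) /\
  (forall m n (i : 'I_(size (G m))) (j : 'I_(size (G n))),
     same_ends (edge_of (occ i)) (edge_of (occ j)) ->
     label (occ i) = label (occ j) -> m = n /\ i = j :> nat).

Definition comm_time : nat := \max_(m : I) task_time (G m).

Definition used (t : nat) (u v : V) : bool := [exists m, (u, v, t) \in G m].

End Collection.

(* A direction, for each time step, for each edge of the graph:
   [o t u v] means that the edge joining [u] and [v] is directed towards [v]. *)
Definition orientation (o : nat -> rel V) : Prop :=
  forall t u v, adj u v -> o t u v = ~~ o t v u.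

End CommunicationGraphs.

Section Hypercube.

Variable d : nat.

Definition cube : finType := {ffun 'I_d -> bool}.

Definition hamming (u v : cube) : nat := #|[set i | u i != v i]|.

Definition cube_adj : rel cube := [rel u v | hamming u v == 1].

Variable Sigma : pred nat.

Definition message : finType :=
  {xy : cube * cube | Sigma (hamming xy.1 xy.2)}.

Definition exchange_graph (G : message -> seq (tedge cube)) : Prop :=
  one_way_comm_graph cube_adj G /\
  forall m : message, is_dipath_from_to (G m) (val m).1 (val m).2.

Definition min_exchange_time (T : nat) : Prop :=
  (exists2 G, exchange_graph G & comm_time G = T) /\
  (forall G, exchange_graph G -> T <= comm_time G).

Definition optimal_exchange (G : message -> seq (tedge cube)) : Prop :=
  exchange_graph G /\
  forall G', exchange_graph G' -> comm_time G <= comm_time G'.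

(* [G0] fixes which edges are used at odd times; whatever directions [o]
   prescribes for them, some optimal [G] uses exactly these edges at odd times,
   directed by [o], each being used in the reverse direction one step later. *)
Definition freely_directable : Prop :=
  exists2 G0, optimal_exchange G0 &
    forall o, orientation cube_adj o ->
      exists2 G, optimal_exchange G &
        forall t, odd t -> forall u v,
          used G t u v = (used G0 t u v || used G0 t v u) && o t u v /\
          (used G t u v -> used G t.+1 v u).

End Hypercube.

(* Main.v *)
(* Let K be the number of sets S of directions of the cube that contain a given
   direction i and satisfy #|S| \in Sigma; it does not depend on i.
   Lower bound: a message from x to y crosses at least |x + y| edges, so the
   messages cross at least 2^d d K edges in total, while each of the d 2^(d-1)
   undirected edges is crossed at most once per time step.
   Upper bound: join each direction i to the sets S containing it. The maximum
   degree of this bipartite graph is K, as #|S| <= K, so by Koenig's theorem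
   its edges have a proper coloring with K colors. Read the color of (i, S) as
   the time at which every message with displacement S crosses direction i:
   this gives a translation-invariant schedule of length K using each directed
   edge at most once per time step. Splitting each time step in two, one for
   each direction of every edge, in the order one likes, makes it one-way. *)
Require Import Defs.
From Stdlib Require Import Classical.
From mathcomp Require Import all_boot all_fingroup.

Set Implicit Arguments.
Unset Strict Implicit.
Unset Printing Implicit Defensive.

(** * Displacements between vertices, and counting over them *)

Definition differ d (u v : cube d) : {set 'I_d} := [set i | u i != v i].

Definition flip d (u : cube d) (S : {set 'I_d}) : cube d :=
  [ffun i => u i (+) (i \in S)].

Lemma differK d (u : cube d) : cancel (differ u) (flip u).
Proof.
by move=> v; apply/ffunP=> i; rewrite !ffunE inE; case: (u i) (v i) => [] [].
Qed.

Lemma flipK d (u : cube d) : cancel (flip u) (differ u).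
Proof.
by move=> S; apply/setP=> i; rewrite inE ffunE; case: (u i) (i \in S) => [] [].
Qed.

Lemma card_cube d : #|cube d| = 2 ^ d.
Proof. by rewrite card_ffun card_bool card_ord. Qed.

Lemma reindex_differ d (u : cube d) (P : pred {set 'I_d})
    (F : {set 'I_d} -> nat) :
  \sum_(v | P (differ u v)) F (differ u v) = \sum_(S | P S) F S.
Proof.
rewrite [RHS](reindex (differ u)) //.
by exists (flip u) => S _; rewrite ?differK ?flipK.
Qed.

Lemma card_cube_adj d :
  #|[set uv : cube d * cube d | cube_adj uv.1 uv.2]| = 2 ^ d * d.
Proof.
rewrite -sum1dep_card -(pair_big_dep xpredT (@cube_adj d) (fun _ _ => 1)) /=.
rewrite -card_cube -sum_nat_const; apply: eq_bigr => u _.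
rewrite (reindex_differ u (fun S => #|S| == 1) (fun=> 1)) sum1dep_card.
have := cards_draws [set: 'I_d] 1; rewrite bin1 cardsT card_ord => cardd.
by rewrite -[RHS]cardd; apply: eq_card => S; rewrite !inE subsetT.
Qed.

(** The degree of direction [i] in the bipartite graph joining directions to the admissible sets
    that contain them. *)
Definition degree d (Sigma : pred nat) (i : 'I_d) :=
  #|[set S : {set 'I_d} | (i \in S) && Sigma #|S|]|.

(** Removing [i] from a set of size [k.+1] leaves an arbitrary [k]-subset of the other
    directions. *)
Lemma degreeE d (Sigma : pred nat) (i : 'I_d) :
  degree Sigma i = \sum_(k < d | Sigma k.+1) 'C(d.-1, k).
Proof.
case: d i => [[]//|d] i; rewrite /degree -sum1dep_card.
have lt_card (S : {set 'I_d.+1}) : i \in S -> #|S|.-1 < d.+1.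
  move=> iS; rewrite ltnS -ltnS prednK; last by apply/card_gt0P; exists i.
  by have := max_card S; rewrite card_ord.
(* By [lt_card] the size less one is in range, so [inord] never takes its default value here. *)
rewrite (partition_big (fun S : {set _} => inord #|S|.-1 : 'I_d.+1)
  (fun k => Sigma k.+1)) /=.
  apply: eq_bigr => k Sk; rewrite sum1dep_card.
  have -> : 'C(d, k) = 'C(#|~: [set i]|, k) by rewrite cardsC1 card_ord.
  rewrite -cards_draws -[RHS](card_in_imset (f := setU [set i])).
    apply: eq_card => S; rewrite inE; apply/idP/imsetP.
      move=> /andP[/andP[iS SS] /eqP kS]; exists (S :\ i);
        last by rewrite setD1K.
      rewrite inE subDset setUCr subsetT /=.
      have := cardsD1 i S; rewrite iS add1n => e.
      by rewrite -kS inordK ?lt_card // e.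
    case=> S'; rewrite inE => /andP[/subsetP sub /eqP cS'] ->.
    have iS' : i \notin S' by apply/negP => /sub; rewrite !inE eqxx.
    have card_iS' : #|i |: S'| = k.+1 by rewrite cardsU1 iS' cS'.
    by rewrite setU11 card_iS' Sk /=; apply/eqP/val_inj; rewrite /= inordK.
  move=> S1 S2; rewrite !inE => /andP[/subsetP iS1 _] /andP[/subsetP iS2 _] e.
  have notin (S' : {set 'I_d.+1}) :
      (forall x, x \in S' -> x \in ~: [set i]) -> (i |: S') :\ i = S'.
    move=> H; apply: setU1K; apply/negP => /H.
    by rewrite !inE eqxx.
  by rewrite -(notin S1) // e notin.
move=> S /andP[iS SS]; rewrite inordK ?lt_card // prednK //.
by apply/card_gt0P; exists i.
Qed.

(** Double counting of the pairs of an admissible set and one of its elements. *)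
Lemma sum_card_sets d (Sigma : pred nat) K :
    (forall i : 'I_d, degree Sigma i = K) ->
  \sum_(S : {set 'I_d} | Sigma #|S|) #|S| = d * K.
Proof.
move=> degK; under eq_bigr do rewrite -sum1_card.
rewrite (exchange_big_dep xpredT) //= -[in RHS](card_ord d) -sum_nat_const.
apply: eq_bigr => i _; rewrite -(degK i) sum1dep_card.
by apply: eq_card => S; rewrite !inE andbC.
Qed.

Lemma sum_hamming d (Sigma : pred nat) K :
    (forall i : 'I_d, degree Sigma i = K) ->
  \sum_(m : message d Sigma) hamming (val m).1 (val m).2 = 2 ^ d * (d * K).
Proof.
move=> degK.
rewrite -(big_sub [pred xy : cube d * cube d | Sigma (hamming xy.1 xy.2)]
  (fun xy => hamming xy.1 xy.2)) /=.
rewrite -(pair_big_dep xpredT (fun x y => Sigma (hamming x y)) (@hamming d)) /=.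
rewrite -card_cube -sum_nat_const; apply: eq_bigr => u _.
by rewrite (reindex_differ u (fun S => Sigma #|S|) (fun S => #|S|))
  (sum_card_sets degK).
Qed.

(** * The lower bound on time *)

Lemma hamming_triangle d (u v w : cube d) :
  hamming u w <= hamming u v + hamming v w.
Proof.
apply: leq_trans (leq_card_setU _ _); apply/subset_leq_card/subsetP => i.
by rewrite !inE; case: (u i) (v i) (w i) => [] [] [].
Qed.

Lemma hamming_last d (x : cube d) (p : seq (cube d)) :
  path (@cube_adj d) x p -> hamming x (last x p) <= size p.
Proof.
elim: p x => [|y p IHp] x /=.
  by move=> _; rewrite leqn0 cards_eq0; apply/eqP/setP=> i; rewrite !inE eqxx.
move=> /andP[/eqP xy yp]; apply: leq_trans (hamming_triangle _ y _) _.
by rewrite xy ltnS IHp.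
Qed.

Lemma path_pairmap (T : Type) (e : rel T) (x : T) (p : seq T) :
  path e x p = all (fun uv => e uv.1 uv.2) (pairmap pair x p).
Proof. by elim: p x => //= y p IHp x; rewrite IHp. Qed.

(** In path order the edges of a message form a walk in the cube, and each step changes a single
    coordinate. *)
Lemma hamming_le_size d Sigma (G : message d Sigma -> seq (tedge (cube d))) m :
  exchange_graph G -> hamming (val m).1 (val m).2 <= size (G m).
Proof.
move=> [[/(_ m)[Gadj _ _ _] _] /(_ m)[w [p [_ <- wE]] permw]].
rewrite -(size_map (@edge_of _)) (perm_size permw) wE size_pairmap.
apply: hamming_last; rewrite path_pairmap -wE -(perm_all _ permw).
apply/allP=> _ /mapP[e eG ->].
by have /tnthP[i ->] : e \in in_tuple (G m) by []; apply: Gadj.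
Qed.

Lemma label_le_comm_time (V I : finType) (G : I -> seq (tedge V)) m e :
  e \in G m -> label e <= comm_time G.
Proof.
move=> eG; apply: leq_trans (leq_bigmax m).
exact: (@leq_bigmax_seq _ _ xpredT (@label V) e).
Qed.

Lemma cube_adjC d : symmetric (@cube_adj d).
Proof.
by move=> u v; congr (_ == 1); apply: eq_card => i; rewrite !inE eq_sym.
Qed.

(* A one-way graph has at most one occurrence per undirected edge and label,
   so the occurrences together with their reverses inject into the labelled
   directed edges. *)
Lemma exchange_lower_bound d (Sigma : pred nat) K
    (G : message d Sigma -> seq (tedge (cube d))) :
    0 < d -> (forall i : 'I_d, degree Sigma i = K) -> exchange_graph G ->
  2 * K <= comm_time G.
Proof.
move=> d0 degK exG; have [[Gtask Gone] _] := exG.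
pose X := {m : message d Sigma & 'I_(size (G m))}.
pose e_ (x : X) := occ (tagged x).
have e_in (x : X) : e_ x \in G (tag x) by apply: mem_tnth.
have e_adj (x : X) : cube_adj (edge_of (e_ x)).1 (edge_of (e_ x)).2.
  by have [Gadj _ _ _] := Gtask (tag x); apply: Gadj.
pose T := comm_time G.
pose f (xb : X * bool) : (cube d * cube d) * 'I_T.+1 :=
  let: (u, v) := edge_of (e_ xb.1) in
  (if xb.2 then (u, v) else (v, u), inord (label (e_ xb.1))).
(* Labels are positive, so discarding [ord0] leaves exactly [T] possible times. *)
pose Y := setX [set uv | @cube_adj d uv.1 uv.2] [set~ (ord0 : 'I_T.+1)].
have fY : f @: setT \subset Y.
  apply/subsetP => _ /imsetP[[x b] _ ->]; rewrite /f /=.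
  have := e_adj x; case E : (edge_of (e_ x)) => [u v] /= uv.
  have [_ /(_ (tagged x)) lpos _ _] := Gtask (tag x).
  rewrite !inE /=; apply/andP; split; first by case: b; rewrite //= cube_adjC.
  apply: contraTneq lpos => /(congr1 val) /=.
  by rewrite inordK ?ltnS ?(label_le_comm_time (e_in x)) // => ->.
have finj : injective f.
  move=> [[m i] b] [[n j] c]; rewrite /f /=.
  set em := e_ _; set en := e_ _.
  have := e_adj (existT _ m i : X); rewrite -/em.
  have := @Gone m n i j; rewrite -[occ i]/em -[occ j]/en.
  case Em : (edge_of em) => [u v]; case En : (edge_of en) => [u' v'] /= one uv.
  move=> e; have el : label em = label en.
    have := congr1 (fun z => val z.2) e; rewrite /= !inordK //.
      by rewrite ltnS; exact: (label_le_comm_time (e_in (existT _ n j : X))).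
    by rewrite ltnS; exact: (label_le_comm_time (e_in (existT _ m i : X))).
  have ends : same_ends (u, v) (u', v').
    case: (b) (c) e => [] [] [-> ->] _; rewrite /same_ends /= eqxx //;
    by rewrite orbT.
  have [emn eij] := one ends el; subst n.
  have {}eij : i = j by apply: val_inj.
  subst j; move: e; have [<- <-] : (u, v) = (u', v') by rewrite -Em -En.
  have uNv : u != v.
    apply: contraTneq uv => ->; rewrite /cube_adj /= /hamming eq_card0 // => k.
    by rewrite inE eqxx.
  by case: (b) (c) => [] [] // [/eqP];
    rewrite ?(negbTE uNv) // eq_sym (negbTE uNv).
have := subset_leq_card fY; rewrite card_imset // cardsT card_prod card_bool.
rewrite cardsX card_cube_adj cardsC1 card_ord card_tagged sumnE big_map.
rewrite big_enum /=.
under eq_bigr do rewrite card_ord.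
have leS : \sum_(m : message d Sigma) hamming (val m).1 (val m).2
    <= \sum_m size (G m).
  by apply: leq_sum => m _; apply: hamming_le_size.
rewrite (sum_hamming degK) in leS => cardX.
(* [cardX] bounds twice the number of occurrences, and [leS] bounds that number from below by the
   total distance. *)
have : 2 ^ d * d * (2 * K) <= 2 ^ d * d * T.
  apply: leq_trans cardX; rewrite [X in _ <= X]mulnC mulnCA leq_mul2l /=.
  by rewrite -mulnA.
by rewrite leq_pmul2l // muln_gt0 expn_gt0.
Qed.

(** * Koenig's edge-coloring theorem *)

(** Induction on the number of edges: color all but [(a, b)], take [al] free at [a] and [be] free at
    [b], exchange the two colors along the alternating path from [b], and give [al] to [(a, b)]. *)
Lemma bipartite_edge_coloring (A B C : finType) (c0 : C) (E : {set A * B}) :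
    (forall a, #|[set b | (a, b) \in E]| <= #|C|) ->
    (forall b, #|[set a | (a, b) \in E]| <= #|C|) ->
  exists c : A -> B -> C,
    (forall a b b', (a, b) \in E -> (a, b') \in E -> c a b = c a b' -> b = b')
    /\ (forall a a' b, (a, b) \in E -> (a', b) \in E -> c a b = c a' b ->
        a = a').
Proof.
move: {2}#|E| (erefl #|E|) => n; elim: n E => [|n IHn] E.
  move=> /cards0_eq-> _ _; exists (fun _ _ => c0).
  by split=> [a b b'|a a' b]; rewrite inE.
move=> cardE degA degB.
have /card_gt0P[[a b] abE] : 0 < #|E| by rewrite cardE.
pose F := E :\ (a, b).
have inF a1 b1 : ((a1, b1) \in F) = ((a1, b1) != (a, b)) && ((a1, b1) \in E).
  by rewrite !inE.
have FE a1 b1 : (a1, b1) \in F -> (a1, b1) \in E by rewrite inF => /andP[].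
have abF : (a, b) \notin F by rewrite inF eqxx.
have [||| c [cA cB]] := IHn F.
- by have := cardsD1 (a, b) E; rewrite abE cardE => -[].
- move=> a1; apply: leq_trans (degA a1); apply: subset_leq_card.
  by apply/subsetP=> b1; rewrite [_ \in _]inE [in X in _ -> X]inE; apply: FE.
- move=> b1; apply: leq_trans (degB b1); apply: subset_leq_card.
  by apply/subsetP=> a1; rewrite [_ \in _]inE [in X in _ -> X]inE; apply: FE.
(* At either end of [(a, b)] the other edges are fewer than the colors, so some color is free. *)
have missing (T : finType) (D : {set T}) (f : T -> C) t :
    t \in D -> #|D| <= #|C| ->
    exists g, forall t', t' \in D -> t' != t -> f t' != g.
  move=> tD leDC.
  have : #|[set f t' | t' in D :\ t]| < #|C|.
    apply: leq_ltn_trans (leq_imset_card _ _) _.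
    by apply: leq_trans leDC; rewrite (cardsD1 t D) tD.
  rewrite -[X in _ < X]cardsT => ltC.
  have /subsetPn[g _ gN] : ~~ ([set: C] \subset [set f t' | t' in D :\ t]).
    by apply: contraL ltC => /subset_leq_card; rewrite -leqNgt.
  exists g => t' t'D t't; apply: contraNneq gN => <-.
  by apply: imset_f; rewrite !inE t't.
have [al missA] : exists al, forall b1, (a, b1) \in F -> c a b1 != al.
  have [|g gP] := missing _ [set b1 | (a, b1) \in E] (c a) b _ (degA a).
    by rewrite inE.
  exists g => b1; rewrite inF xpair_eqE eqxx /= => /andP[b1b abE1].
  by apply: gP; rewrite ?inE.
have [be missB] : exists be, forall a1, (a1, b) \in F -> c a1 b != be.
  have [|g gP] := missing _ [set a1 | (a1, b) \in E] (c^~ b) a _ (degB b).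
    by rewrite inE.
  exists g => a1; rewrite inF xpair_eqE eqxx andbT => /andP[b1b abE1].
  by apply: gP; rewrite ?inE.
(* The part of the alternating al/be path from [b] that lies in [B]; the
   bipartition keeps it away from [a], which has no al-edge. *)
pose r : rel B := [rel b1 b2 | [exists a1,
  [&& (a1, b1) \in F, c a1 b1 == al, (a1, b2) \in F & c a1 b2 == be]]].
have fwd a1 b1 b2 : connect r b b1 -> (a1, b1) \in F -> c a1 b1 = al ->
    (a1, b2) \in F -> c a1 b2 = be -> connect r b b2.
  move=> bb1 F1 c1 F2 c2; apply: connect_trans bb1 (connect1 _).
  by apply/existsP; exists a1; rewrite F1 F2 c1 c2 !eqxx.
(* As [be] is free at [b], the path reached [b1] through a [be]-edge; by properness that edge comes
   from [a1], which was itself entered by an [al]-edge. *)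
have bwd a1 b1 : connect r b b1 -> (a1, b1) \in F -> c a1 b1 = be ->
    exists b0, [/\ connect r b b0, (a1, b0) \in F & c a1 b0 = al].
  move=> /connectP[p]; case/lastP: p => [|p b2] /=.
    by move=> _ -> /missB/eqP.
  rewrite rcons_path last_rcons => /andP[bp].
  move=> /existsP[a2 /and4P[F0 /eqP c0al F2 /eqP c2]] -> F1 c1.
  have eqa : a1 = a2 by apply: (cB _ _ b2); rewrite // c1 c2.
  exists (last b p); rewrite eqa; split=> //.
  by apply/connectP; exists p.
pose sw := tperm al be.
pose c' a1 b1 := if (a1, b1) == (a, b) then al
  else if connect r b b1 then sw (c a1 b1) else c a1 b1.
have c'F a1 b1 : (a1, b1) \in F ->
    c' a1 b1 = if connect r b b1 then sw (c a1 b1) else c a1 b1.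
  by rewrite inF /c' => /andP[/negbTE->].
have c'ab : c' a b = al by rewrite /c' eqxx.
have Ecase a1 b1 : (a1, b1) \in E -> (a1 = a /\ b1 = b) \/ (a1, b1) \in F.
  by rewrite inF => ->; rewrite andbT; case: eqP => [[-> ->]|_]; [left|right].
(* A new [al] at [a] would come from a swapped [be]-edge, and [bwd] would then give an [al]-edge
   already present at [a]. *)
have newA b1 : (a, b1) \in F -> c' a b1 != al.
  move=> F1; rewrite c'F //; case: ifP => bb1; last exact: missA.
  apply/eqP => swal; have cbe : c a b1 = be.
    by apply: (@perm_inj _ sw); rewrite swal tpermR.
  by have [b0 [_ F0 c0al]] := bwd _ _ bb1 F1 cbe; have /eqP := missA _ F0.
have newB a1 : (a1, b) \in F -> c' a1 b != al.
  move=> F1; rewrite c'F // connect0; apply/eqP => swal.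
  have /eqP := missB _ F1; apply.
  by apply: (@perm_inj _ sw); rewrite swal tpermR.
(* If the swap made a swapped and an unswapped edge at [a1] agree in [al] or [be], then [fwd] or
   [bwd] would put [b2] on the path too. *)
have mixed a1 b1 b2 : (a1, b1) \in F -> (a1, b2) \in F -> connect r b b1 ->
    ~~ connect r b b2 -> sw (c a1 b1) = c a1 b2 -> b1 = b2.
  move=> F1 F2 r1 r2; rewrite /sw; case: tpermP => [c1 c2|c1 c2|_ _].
  - by case/negP: r2; apply: (fwd a1 b1).
  - have [b0 [r0 F0 e0]] := bwd _ _ r1 F1 c1.
    by case/negP: r2; rewrite -(cA a1 b0 b2) // e0.
  - exact: cA.
exists c'; split=> [a1 b1 b2|a1 a2 b1] /Ecase[[-> ->]|F1] /Ecase.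
- case=> [[_ ->]//|F2]; rewrite c'ab => e.
  by have := newA _ F2; rewrite -e eqxx.
- case=> [[ea ->]|F2].
    by move: F1; rewrite ea c'ab => F1 e; have := newA _ F1; rewrite e eqxx.
  rewrite !c'F //; case: ifPn => r1; case: ifPn => r2.
  + by move/perm_inj; apply: cA.
  + exact: mixed.
  + by move/esym => e; apply/esym; apply: (mixed a1).
  + exact: cA.
- case=> [[-> _]//|F2]; rewrite c'ab => e.
  by have := newB _ F2; rewrite -e eqxx.
- case=> [[-> eb]|F2].
    by move: F1; rewrite eb c'ab => F1 e; have := newB _ F1; rewrite e eqxx.
  rewrite !c'F //; case: ifPn => r1; last exact: cB.
  by move/perm_inj; apply: cB.
Qed.

(** * Task graphs from labels increasing along consecutive edges *)

Lemma pairmap_pair_path (T : Type) (V : eqType) (f : T -> V * V) (e : T)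
    (es : seq T) x p :
  map f (e :: es) = pairmap pair x p ->
  path (fun a b => (f a).2 == (f b).1) e es.
Proof.
elim: es e x p => //= e' es IHes e x [|y [|z p]] //= [-> fe' fes].
by rewrite fe' eqxx (IHes e' y (z :: p)) //= fe' fes.
Qed.

(* Labels increase along the directed paths of [E], so [precedes i j] forces
   the label of [i] to be at most that of [j]. *)
Lemma task_graph_chained (V : finType) (adj : rel V) (E : seq (tedge V)) :
    {in E, forall e, adj (edge_of e).1 (edge_of e).2} ->
    {in E, forall e, 0 < label e} ->
    {in E &, forall e e',
      (edge_of e).2 = (edge_of e').1 -> label e < label e'} ->
  task_graph adj E.
Proof.
move=> Eadj Epos Echain.
have occE i : @occ _ E i \in E by apply: mem_tnth.
have prec i j : @precedes _ E i j -> i = j \/ label (occ i) < label (occ j).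
  move=> [ks [<- [x [y [p [_ _ pE]]]]]].
  have: path (fun a b => label (@occ _ E a) < label (occ b)) i ks.
    have := pairmap_pair_path pE; apply: sub_path => a b /eqP.
    by apply: Echain.
  move/order_path_min => /(_ (fun _ _ _ => @ltn_trans _ _ _))/allP.
  by case: ks {pE} => [|k ks] lt_i; [left|right; exact: lt_i (mem_last k ks)].
split=> [i|i|i j lt_ij|i j eq_ij].
- exact: Eadj.
- exact: Epos.
- case: (classic (precedes i j)) => [|nij]; first by left.
  right; split=> // /prec[eji|]; first by rewrite eji ltnn in lt_ij.
  by rewrite ltnNge ltnW.
- case: (eqVneq i j) => [|/eqP ij]; [by left|right].
  by split=> /prec[/esym//|]; rewrite eq_ij ltnn.
Qed.

(** * Schedules built from colorings *)

(** The position of a message just before it crosses [i], directions being crossed by increasing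
    color. The closed form avoids recursion along the path and makes translations easy to
    compute. *)
Definition before d (c : 'I_d -> {set 'I_d} -> nat) x (D : {set 'I_d}) i :
    cube d :=
  flip x [set j in D | c j D < c i D].

Definition after d (c : 'I_d -> {set 'I_d} -> nat) x (D : {set 'I_d}) i :
    cube d :=
  flip x [set j in D | c j D <= c i D].

(** Two-way steps count from 0 and labels from 1, so step [t] splits into the labels 2t+1 and 2t+2;
    the direction chosen by [o] goes first. *)
Definition half_step (V : Type) (o : nat -> rel V) t u v :=
  if o t.*2.+1 u v then t.*2.+1 else t.*2.+2.

Definition flip_order d (c : 'I_d -> {set 'I_d} -> nat) (D : {set 'I_d}) :=
  sort (fun i j => c i D <= c j D) (enum D).

(* In a two-way schedule, the message from [x] to [flip x D] crosses direction
   [i \in D] at time [c i D]; each time step is then split in two, so that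
   the two directions of an edge are used one after the other. *)
Definition schedule d Sigma (c : 'I_d -> {set 'I_d} -> nat)
    (o : nat -> rel (cube d)) (m : message d Sigma) : seq (tedge (cube d)) :=
  let x := (val m).1 in let D := differ x (val m).2 in
  [seq (before c x D i, after c x D i,
        half_step o (c i D) (before c x D i) (after c x D i))
     | i <- flip_order c D].

Lemma mem_flip_order d c (D : {set 'I_d}) i :
  (i \in flip_order c D) = (i \in D).
Proof. by rewrite mem_sort mem_enum. Qed.

Lemma flip_order_uniq d c (D : {set 'I_d}) : uniq (flip_order c D).
Proof. by rewrite sort_uniq enum_uniq. Qed.

(** Induction on the directions [s2] still to cross: those in [s1] have been crossed, so the message
    stands at [x] flipped along [s1]. *)
Lemma flip_pairmap d c (x : cube d) (D : {set 'I_d}) s1 s2 :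
    {in D &, injective (c^~ D)} -> flip_order c D = s1 ++ s2 ->
  pairmap pair (flip x [set j in s1]) [seq after c x D i | i <- s2]
  = [seq (before c x D i, after c x D i) | i <- s2].
Proof.
move=> cinj; elim: s2 s1 => //= i s2 IHs2 s1 sE.
have : sorted (fun i j => c i D <= c j D) (flip_order c D).
  by apply: sort_sorted => j k; apply: leq_total.
rewrite sorted_pairwise; last by move=> ? ? ?; apply: leq_trans.
rewrite sE pairwise_cat allrel_consr => /and3P[/andP[/allP le1 _] _] /=.
move=> /andP[/allP le2 _].
have memD j : (j \in D) = (j \in s1) || (j == i) || (j \in s2).
  by rewrite -(mem_flip_order c) sE mem_cat inE orbA.
have iD : i \in D by rewrite memD eqxx orbT.
have lt2 j : j \in s2 -> c i D < c j D.
  move=> js2; rewrite ltn_neqAle le2 // andbT.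
  apply/eqP => /cinj eij; have := flip_order_uniq c D.
  by rewrite sE cat_uniq /= eij ?iD ?memD ?js2 ?eqxx ?orbT //= !andbF.
have lt1 j : j \in s1 -> c j D < c i D.
  move=> js1; rewrite ltn_neqAle le1 // andbT.
  apply/eqP => /cinj eij; have := flip_order_uniq c D.
  by rewrite sE cat_uniq /= -eij ?iD ?memD ?js1 ?eqxx ?orbT //= !andbF.
have -> : flip x [set j in s1] = before c x D i.
  congr flip; apply/setP => j; rewrite !inE memD.
  have [/lt1->//|_] := boolP (j \in s1).
  by have [->|_] := eqVneq j i; rewrite /= ?ltnn //;
    case: (boolP (j \in s2)) => // /lt2; rewrite ltnNge leq_eqVlt; case: ltngtP.
have eqa : after c x D i = flip x [set j in rcons s1 i].
  congr flip; apply/setP => j; rewrite !inE memD mem_rcons inE.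
  have [/lt1/ltnW->//|_] := boolP (j \in s1); first by rewrite orbT.
  have [->|_] := eqVneq j i; rewrite /= ?leqnn //.
  by case: (boolP (j \in s2)) => // /lt2; rewrite ltnNge => /negbTE.
congr (_ :: _); rewrite [in LHS]eqa; apply: IHs2.
by rewrite sE cat_rcons.
Qed.

(** Properness at directions keeps different displacements from crossing the same direction at once;
    properness at sets orders the crossings of a message strictly. *)
Definition proper_coloring d (Sigma : pred nat)
    (c : 'I_d -> {set 'I_d} -> nat) :=
  (forall i (S S' : {set 'I_d}),
     i \in S -> Sigma #|S| -> i \in S' -> Sigma #|S'| ->
     c i S = c i S' -> S = S')
  /\ (forall S : {set 'I_d}, Sigma #|S| -> {in S &, injective (c^~ S)}).

Lemma half_stepK (V : Type) (o : nat -> rel V) t u v :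
  (half_step o t u v).-1./2 = t.
Proof.
by rewrite /half_step; case: ifP => _ /=; rewrite ?uphalf_double ?doubleK.
Qed.

Lemma half_step_ltn (V : Type) (o : nat -> rel V) t t' u v u' v' :
  t < t' -> half_step o t u v < half_step o t' u' v'.
Proof.
move=> lt_t; apply: (@leq_ltn_trans t.+1.*2).
  by rewrite /half_step doubleS; case: ifP.
apply: (@leq_trans t'.*2.+1); first by rewrite ltnS leq_double.
by rewrite /half_step; case: ifP.
Qed.

Lemma half_step_rev (V : finType) (adj : rel V) (o : nat -> rel V) t u v :
  orientation adj o -> adj u v -> half_step o t u v != half_step o t v u.
Proof.
move=> orient uv; rewrite /half_step (orient _ _ _ uv).
by case: (o _ v u); rewrite /= !eqSS ?[_ == _.+1]eq_sym eqn_leq ltnn ?andbF.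
Qed.

Lemma flip_inj d (S : {set 'I_d}) : injective (fun u : cube d => flip u S).
Proof.
move=> u v /ffunP uv; apply/ffunP => i; have := uv i; rewrite !ffunE.
exact: addIb.
Qed.

Lemma differC d (u v : cube d) : differ u v = differ v u.
Proof. by apply/setP => i; rewrite !inE eq_sym. Qed.

Lemma differ_before_after d c (x : cube d) (D : {set 'I_d}) i :
    {in D &, injective (c^~ D)} -> i \in D ->
  differ (before c x D i) (after c x D i) = [set i].
Proof.
move=> cinj iD; apply/setP => j; rewrite !inE !ffunE !inE.
have -> : (j == i) = (j \in D) && (c j D == c i D).
  apply/eqP/andP => [->|[jD /eqP]]; [by rewrite iD | exact: cinj].
by case: (x j) (j \in D) (ltngtP (c j D) (c i D)) => [] [] [].
Qed.

Lemma after_eq_before d (c : 'I_d -> {set 'I_d} -> nat) (x : cube d)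
    (D : {set 'I_d}) i j :
  i \in D -> after c x D i = before c x D j -> c i D < c j D.
Proof.
move=> iD /(can_inj (flipK x))/setP/(_ i).
by rewrite !inE iD leqnn => /esym.
Qed.

Lemma scheduleP d Sigma c o (m : message d Sigma) e :
  let x := (val m).1 in let D := differ x (val m).2 in
  reflect (exists2 i, i \in D & e = (before c x D i, after c x D i,
             half_step o (c i D) (before c x D i) (after c x D i)))
    (e \in schedule c o m).
Proof.
apply: (iffP mapP) => -[i iD ->]; exists i => //.
  by rewrite mem_flip_order in iD.
by rewrite mem_flip_order.
Qed.

Lemma schedule_dipath d Sigma c o (m : message d Sigma) :
  proper_coloring Sigma c ->
  is_dipath_from_to (schedule c o m) (val m).1 (val m).2.
Proof.
case: m => [[x y] mS] [_ /(_ (differ x y) mS) cinj].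
set D := differ x y in cinj; rewrite /schedule /= -/D.
exists [seq (before c x D i, after c x D i) | i <- flip_order c D]; last first.
  by rewrite -map_comp.
have afterD i j : j \in D -> (after c x D i j != x j) = (c j D <= c i D).
  by move=> jD; rewrite ffunE inE jD; case: (x j) (_ <= _) => [] [].
exists [seq after c x D i | i <- flip_order c D]; split.
- rewrite /=; apply/andP; split.
    apply/mapP => -[i]; rewrite mem_flip_order => iD xE.
    by have := afterD i i iD; rewrite -xE eqxx leqnn.
  rewrite map_inj_in_uniq ?flip_order_uniq // => i j.
  rewrite !mem_flip_order => iD jD eij; apply: cinj => //.
  (* Both [i] and [j] are flipped at the common vertex, so each color is at most the other. *)
  by apply/eqP; rewrite eqn_leq -!afterD // eij -{1}eij !afterD // !leqnn.
- rewrite -[RHS](differK x); apply/ffunP => j; rewrite [in RHS]ffunE -/D.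
  (* The last direction in sorted order has the largest color, so all of [D] is flipped after it. *)
  case/lastP E : (flip_order c D) => [|s i].
    by rewrite -(mem_flip_order c) E /= addbF.
  rewrite map_rcons last_rcons ffunE inE; congr (_ (+) _).
  apply: andb_idr; rewrite -(mem_flip_order c) E mem_rcons inE.
  have : sorted (fun i j => c i D <= c j D) (flip_order c D).
    by apply: sort_sorted => k l; apply: leq_total.
  rewrite sorted_pairwise; last by move=> ? ? ?; apply: leq_trans.
  rewrite E pairwise_rcons => /andP[/allP le_i _].
  by case/predU1P => [->|/le_i].
- rewrite -(@flip_pairmap _ c x D [::]) //; congr pairmap.
  by apply/ffunP => j; rewrite ffunE inE addbF.
Qed.

(** Two clashing occurrences share their direction and color, hence their displacement by
    properness. Opposite traversals get different halves of a step, so the sources also agree and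
    the messages coincide. *)
Lemma schedule_exchange d Sigma c o :
    proper_coloring Sigma c -> orientation (@cube_adj d) o ->
  exchange_graph (@schedule d Sigma c o).
Proof.
move=> properc orient; have [cA cB] := properc.
have adj_step (x y : cube d) i : Sigma (hamming x y) -> i \in differ x y ->
    let D := differ x y in cube_adj (before c x D i) (after c x D i).
  move=> xyS iD; rewrite /cube_adj /= /hamming.
  by have := differ_before_after x (cB _ xyS) iD; rewrite /differ => ->;
    rewrite cards1.
split; last by move=> m; apply: schedule_dipath.
split=> [m|m n a b].
  apply: task_graph_chained.
  - by move=> e /scheduleP[i iD ->]; apply: adj_step => //; apply: (valP m).
  - move=> e /scheduleP[i iD ->]; rewrite /label /half_step /=.
    by case: ifP.
  - move=> e e' /scheduleP[i iD ->] /scheduleP[j jD ->] /(after_eq_before iD).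
    exact: half_step_ltn.
have a_in : occ a \in schedule c o m by apply: mem_tnth.
have b_in : occ b \in schedule c o n by apply: mem_tnth.
case/scheduleP: (a_in) => i; case/scheduleP: (b_in) => j.
move: (valP m) (valP n) => /=.
set x := (val m).1; set D := differ x _.
set x' := (val n).1; set D' := differ x' _.
move=> mS nS jD' eb iD ea; rewrite eb ea /edge_of /label /= => ends elab.
have eij : i = j.
  apply/set1P; rewrite -(differ_before_after x' (cB _ nS) jD').
  have : i \in differ (before c x D i) (after c x D i).
    by rewrite (differ_before_after x (cB _ mS) iD) set11.
  by case/orP: ends => /eqP[-> ->] //=; rewrite differC.
have ecol : c i D = c j D'.
  by have := congr1 (fun t => t.-1./2) elab; rewrite !half_stepK.
subst j; have eD : D = D' by apply: cA ecol.
rewrite -eD in ends elab eb.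
have ebefore : before c x D i = before c x' D i.
  case/orP: ends => /eqP[] // e1 e2; move: elab; rewrite e1 e2 /= => /eqP.
  have := half_step_rev (c i D) orient (adj_step _ _ _ mS iD).
  by rewrite -/D e1 e2 => /negPf->.
have ex : x = x' by apply: flip_inj ebefore.
have emn : m = n.
  apply: val_inj; rewrite [LHS]surjective_pairing [RHS]surjective_pairing.
  congr pair => //; rewrite -(differK x (val m).2) -(differK x' (val n).2).
  by rewrite -/D -/D' eD ex.
split=> //; subst n; apply/eqP.
have : uniq (schedule c o m).
  rewrite map_inj_in_uniq ?flip_order_uniq // => k l.
  rewrite !mem_flip_order -/D => kD lD.
  by case=> _ _ /(congr1 (fun t => t.-1./2)); rewrite !half_stepK; apply: cB.
move/(nth_uniq (occ a)) => <- //.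
have occE (k : 'I_(size (schedule c o m))) :
    nth (occ a) (schedule c o m) k = occ k.
  by rewrite [RHS](tnth_nth (occ a)).
by rewrite !occE ea eb ex.
Qed.

(** * Edges used at each time, and their reversal *)

(** Edge use in the two-way schedule, before any orientation is chosen; this is the part common to
    all the one-way schedules. *)
Definition crosses d Sigma (c : 'I_d -> {set 'I_d} -> nat) t (u v : cube d) :=
  [exists m : message d Sigma, exists i : 'I_d,
    let x := (val m).1 in let D := differ x (val m).2 in
    [&& i \in D, before c x D i == u, after c x D i == v & c i D == t]].

Lemma crossesP d Sigma c t (u v : cube d) :
  reflect (exists (m : message d Sigma) i,
             let x := (val m).1 in let D := differ x (val m).2 in
             [/\ i \in D, before c x D i = u, after c x D i = v & c i D = t])
    (crosses Sigma c t u v).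
Proof.
apply: (iffP existsP) => [[m /existsP[i /and4P[iD /eqP bu /eqP av /eqP ct]]]|].
  by exists m, i.
case=> m [i /= [iD bu av ct]]; exists m; apply/existsP; exists i.
by rewrite /= iD bu av ct !eqxx.
Qed.

(** Only coordinate [i] separates the two ends of the crossing: any other direction of [D] has a
    different color, so strict and weak comparison agree on it. *)
Lemma before_flip1 d c (x : cube d) (D : {set 'I_d}) i :
    {in D &, injective (c^~ D)} -> i \in D ->
  before c (flip x [set i]) D i = after c x D i.
Proof.
move=> cinj iD; apply/ffunP => j; rewrite !ffunE !inE -addbA; congr (_ (+) _).
have [->|ji] := eqVneq j i; first by rewrite iD ltnn leqnn.
case: (boolP (j \in D)) => //= jD; rewrite [in RHS]leq_eqVlt.
by rewrite (inj_in_eq cinj) // (negPf ji).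
Qed.

Lemma after_flip1 d c (x : cube d) (D : {set 'I_d}) i :
    {in D &, injective (c^~ D)} -> i \in D ->
  after c (flip x [set i]) D i = before c x D i.
Proof.
move=> cinj iD; rewrite -before_flip1 //; congr before.
by apply/ffunP => j; rewrite !ffunE -addbA addbb addbF.
Qed.

(* Translating the message by the crossed direction reverses the crossing. *)
Lemma crossesC d Sigma c t :
  proper_coloring Sigma c -> symmetric (@crosses d Sigma c t).
Proof.
move=> [_ cB].
suff sym u v : crosses Sigma c t u v -> crosses Sigma c t v u.
  by move=> u v; apply/idP/idP; apply: sym.
case/crossesP=> [[[x y] xyS] [i /= [iD bu av ct]]].
have cinj := cB _ xyS; rewrite -/(differ x y) in cinj.
set D := differ x y in iD bu av ct cinj.
have eD : differ (flip x [set i]) (flip y [set i]) = D.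
  by apply/setP => j; rewrite !inE !ffunE (inj_eq (@addIb _)).
have xyS' : Sigma (hamming (flip x [set i]) (flip y [set i])).
  by rewrite /hamming -/(differ _ _) eD.
apply/crossesP; exists (exist _ (flip x [set i], flip y [set i]) xyS'), i => /=.
by rewrite eD before_flip1 // after_flip1 // bu av.
Qed.

Lemma crosses_adj d Sigma c t (u v : cube d) :
  proper_coloring Sigma c -> crosses Sigma c t u v -> cube_adj u v.
Proof.
move=> [_ cB] /crossesP[m [i /= [iD <- <- _]]].
have := differ_before_after (val m).1 (cB _ (valP m)) iD.
by rewrite /cube_adj /= /hamming -/(differ _ _) => ->; rewrite cards1.
Qed.

Lemma used_schedule d Sigma c o t (u v : cube d) :
  used (@schedule d Sigma c o) t u v =
  crosses Sigma c t.-1./2 u v && (half_step o t.-1./2 u v == t).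
Proof.
apply/existsP/andP => [[m /scheduleP[i iD [-> -> ->]]]|].
  rewrite half_stepK eqxx; split=> //; apply/crossesP.
  by exists m, i.
case=> /crossesP[m [i /= [iD bu av ct]]] /eqP et; exists m.
by apply/scheduleP; exists i; rewrite // bu av ct et.
Qed.

Lemma comm_time_schedule d Sigma c o K :
    (forall i S, c i S < K) ->
  comm_time (@schedule d Sigma c o) <= 2 * K.
Proof.
move=> cK; apply/bigmax_leqP => m _; apply/bigmax_leqP_seq => e em _.
move: em => /scheduleP[i iD ->]; rewrite /label /= mul2n.
apply: (@leq_trans (c i (differ (val m).1 (val m).2)).+1.*2).
  by rewrite /half_step doubleS; case: ifP.
by rewrite leq_double cK.
Qed.

Lemma exists_orientation d : exists o, orientation (@cube_adj d) o.
Proof.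
(* Any total order on the vertices orients every edge. *)
exists (fun _ u v => enum_rank u < enum_rank v) => _ u v /eqP uv.
rewrite -leqNgt ltn_neqAle [in LHS]andb_idl // => _.
apply: contra_eq_neq uv => /val_inj/enum_rank_inj->.
by rewrite /hamming eq_card0 // => i; rewrite inE eqxx.
Qed.

(** * Optimal schedules and the three distance sets *)

Lemma exists_proper_coloring d Sigma K :
    0 < K -> (forall i : 'I_d, degree Sigma i = K) ->
    (forall s, s <= d -> Sigma s -> s <= K) ->
  exists c, @proper_coloring d Sigma c /\ forall i S, c i S < K.
Proof.
move=> K0 degK leK.
pose E := [set iS : 'I_d * {set 'I_d} | (iS.1 \in iS.2) && Sigma #|iS.2|].
have [||c [cA cB]] := @bipartite_edge_coloring _ _ 'I_K (Ordinal K0) E.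
- move=> i; rewrite card_ord -(degK i); apply/subset_leq_card/subsetP => S.
  by rewrite !inE.
- move=> S; rewrite card_ord; have [SS|SS] := boolP (Sigma #|S|).
    apply: (@leq_trans #|S|); last first.
      by apply: leK SS; have := max_card S; rewrite card_ord.
    by apply/subset_leq_card/subsetP => i; rewrite !inE => /andP[].
  by rewrite eq_card0 // => i; rewrite !inE (negPf SS) andbF.
exists (fun i S => nat_of_ord (c i S)); split=> [|i S]; last exact: ltn_ord.
split=> [i S S' iS SS iS' SS' /val_inj|S SS i j iS jS /val_inj].
  by apply: cA; rewrite inE ?iS ?iS'.
by apply: cB; rewrite inE ?iS ?jS.
Qed.

(** A single coloring serves all orientations: [o] only decides which direction of an edge comes
    first within a doubled step, and the length stays optimal. *)
Lemma regular_exchange d (Sigma : pred nat) K :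
    0 < d -> 0 < K -> (forall i : 'I_d, degree Sigma i = K) ->
    (forall s, s <= d -> Sigma s -> s <= K) ->
  min_exchange_time d Sigma (2 * K) /\ freely_directable d Sigma.
Proof.
move=> d0 K0 degK leK.
have [c [properc cK]] := exists_proper_coloring K0 degK leK.
have lower (G : message d Sigma -> seq (tedge (cube d))) :
    exchange_graph G -> 2 * K <= comm_time G.
  exact: (exchange_lower_bound d0 degK).
have optimal o : orientation (@cube_adj d) o ->
    optimal_exchange (@schedule d Sigma c o).
  move=> orient; split; first exact: schedule_exchange.
  by move=> G /lower; apply: leq_trans; apply: comm_time_schedule.
have [o0 orient0] := exists_orientation d.
split.
  split=> //; exists (schedule c o0); first by case: (optimal _ orient0).
  apply/eqP; rewrite eqn_leq comm_time_schedule // lower //.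
  by case: (optimal _ orient0).
exists (schedule c o0); first exact: optimal.
move=> o orient; exists (schedule c o); first exact: optimal.
move=> t odd_t u v.
have {odd_t} -> : t = t./2.*2.+1 by rewrite odd_halfK // prednK // odd_gt0.
move: t./2 => {}t.
have first_half (o' : nat -> rel (cube d)) u' v' :
    (half_step o' t u' v' == t.*2.+1) = o' t.*2.+1 u' v'.
  by rewrite /half_step; case: ifP; rewrite ?eqxx // eqSS eqn_leq ltnn.
rewrite !used_schedule /= uphalf_double doubleK !first_half.
rewrite [crosses _ _ _ v u]crossesC //.
case: (boolP (crosses Sigma c t u v)) => //= /crosses_adj-/(_ properc) uv.
(* Exactly one direction of the edge obeys [o0], so up to direction [schedule c o0] uses every
   crossed edge at this odd time. The direction rejected by [o] falls in the next step. *)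
rewrite (orient0 _ _ _ uv) orNb; split=> // ouv.
by rewrite /half_step -[o _ v u]negbK -(orient _ _ _ uv) ouv.
Qed.

Theorem theorem6p5 (d : nat) (hd : 2 <= d) :
  [/\ min_exchange_time d [pred k | 1 <= k <= d] (2 ^ d),
      min_exchange_time d (pred2 d.-1 d) (2 * d),
      forall s : nat, 1 <= s <= d.-1 ->
        min_exchange_time d (pred1 s) (2 * 'C(d.-1, s.-1))
    & [/\ freely_directable d [pred k | 1 <= k <= d],
          freely_directable d (pred2 d.-1 d)
        & forall s : nat, 1 <= s <= d.-1 -> freely_directable d (pred1 s)]].
Proof.
have d0 : 0 < d by apply: leq_trans hd.
have [] := @regular_exchange d [pred k | 1 <= k <= d] (2 ^ d.-1) d0.
- by rewrite expn_gt0.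
- move=> i; rewrite degreeE; case: d hd {d0 i} => // d _.
  rewrite /= -[2]/(1 + 1) expnDn; apply: eq_big => k;
    first by rewrite /= ltn_ord.
  by rewrite !exp1n !muln1.
- move=> s s_d _; rewrite -(prednK d0) in s_d.
  (* A set has at most d elements, and d-1 < 2^(d-1). *)
  exact: leq_trans s_d (ltn_expl _ _).
rewrite -expnS prednK // => minU dirU.
have [] := @regular_exchange d (pred2 d.-1 d) d d0 d0.
- move=> i; rewrite degreeE; case: d hd {d0 i minU dirU} => [|[|d]] // _.
  (* Only the last two binomials survive: C(d-1, d-2) + C(d-1, d-1) = d for the original [d]. *)
  rewrite big_mkcond !big_ord_recr /= !eqSS !eqxx orbT /= binn.
  rewrite big1 ?add0n; last first.
    by move=> k _; rewrite !eqSS !ltn_eqF // (leq_trans (ltn_ord k)).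
  by rewrite binSn addn1.
- by [].
move=> min2 dir2.
have one s : 1 <= s <= d.-1 ->
    min_exchange_time d (pred1 s) (2 * 'C(d.-1, s.-1))
    /\ freely_directable d (pred1 s).
  move=> /andP[s0 s_d].
  apply: regular_exchange => //.
  - by rewrite bin_gt0 (leq_trans (leq_pred s)).
  - move=> i; rewrite degreeE.
    have s_lt : s.-1 < d by rewrite (leq_trans _ (leq_pred d)) // prednK.
    rewrite (big_pred1 (Ordinal s_lt)) // => k /=.
    by rewrite -val_eqE /= -[in LHS](prednK s0) eqSS.
  (* Here s = C(s, s-1), at most C(d-1, s-1) because s is at most d-1. *)
  - move=> _ _ /eqP->; rewrite -{1}(prednK s0).
    move: s0 s_d; case: s => // s _ s_d; rewrite /= -[X in X <= _](binSn s).
    exact: leq_bin2l.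
split=> //; first by move=> s /one[].
by split=> // s /one[].
Qed.
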